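(* Let $\mathbb F\in\{\mathbb R,\mathbb C\}$ and let $P(\lambda)=\lambda(J_1+R_1)+(J_2+R_2)\in\mathbb F^{n,n}[\lambda]$, where $J_i^*=-J_i$ and $R_i^*=R_i\ge 0$ for $i=1,2$. Then the ordered lists of left and right minimal indices of $P(\lambda)$ coincide.
   Context: $M^*$ denotes the conjugate transpose, $M\ge 0$ means Hermitian positive semidefinite. The left and right minimal indices of a pencil are read off its Kronecker canonical form: under multiplication from left and right by constant invertible complex matrices the pencil becomes block diagonal, uniquely up to block permutation, with blocks $\mathcal L_\epsilon=\lambda[\,I_\epsilon\;0\,]-[\,0\;I_\epsilon\,]$ of size $\epsilon\times(\epsilon+1)$ ($\epsilon\ge0$), transposed blocks $\mathcal L_\eta^\top$ of size $(\eta+1)\times\eta$ ($\eta\ge 0$), blocks $\lambda I_\rho-\mathcal J_\rho(\lambda_i)$ and blocks $\lambda\mathcal J_\sigma(0)-I_\sigma$ ($\mathcal J_k(\lambda_0)$ the $k\times k$ Jordan block). The numbers $\epsilon$ are the right minimal indices, the numbers $\eta$ are the left minimal indices (both listed with repetition). *)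

(* Defs.v *)
From HB Require Import structures.
From mathcomp Require Import all_boot all_order all_algebra.
From mathcomp Require Import spectral reals complex.
Set Implicit Arguments.
Unset Strict Implicit.
Unset Printing Implicit Defensive.
Import Order.TTheory GRing.Theory Num.Theory.
Local Open Scope ring_scope.
Local Open Scope sesquilinear_scope.

(* For a complex number z, [0 <= z] means that z is real and nonnegative. *)
Definition psdmx (C : numClosedFieldType) (n : nat) (M : 'M[C]_n) : Prop :=
  M ^t* = M /\ forall x : 'cV[C]_n, 0 <= (x ^t* *m M *m x) 0 0.

Definition pencil (F : fieldType) (m n : nat) (A B : 'M[F]_(m, n)) :
    'M[{poly F}]_(m, n) :=
  'X *: map_mx polyC A + map_mx polyC B.

Section Kronecker.
Variable F : fieldType.

Definition jordan_block (k : nat) (mu : F) : 'M[F]_k :=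
  \matrix_(i, j) (mu *+ (j == i) + (j == i.+1 :> nat)%:R).

(* [I_e 0] and [0 I_e] *)
Definition id_zero (e : nat) : 'M[F]_(e, e.+1) :=
  \matrix_(i, j) (j == i :> nat)%:R.
Definition zero_id (e : nat) : 'M[F]_(e, e.+1) :=
  \matrix_(i, j) (j == i.+1 :> nat)%:R.

Definition singular_block (e : nat) : 'M[{poly F}]_(e, e.+1) :=
  pencil (id_zero e) (- zero_id e).

Inductive kblock :=
  | RightSingular of nat
  | LeftSingular of nat
  | FiniteJordan of nat & F
  | InfiniteJordan of nat.

(* Jordan blocks have positive size, while the singular blocks may have
   size 0 x 1 or 1 x 0. *)
Definition kblock_wf (b : kblock) : bool :=
  match b with
  | RightSingular _ | LeftSingular _ => true
  | FiniteJordan k _ | InfiniteJordan k => (0 < k)%N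
  end.

Definition kblock_rows (b : kblock) : nat :=
  match b with
  | RightSingular e => e
  | LeftSingular e => e.+1
  | FiniteJordan k _ | InfiniteJordan k => k
  end.

Definition kblock_cols (b : kblock) : nat :=
  match b with
  | RightSingular e => e.+1
  | LeftSingular e => e
  | FiniteJordan k _ | InfiniteJordan k => k
  end.

Definition kblock_mx (b : kblock) :
    'M[{poly F}]_(kblock_rows b, kblock_cols b) :=
  match b with
  | RightSingular e => singular_block e
  | LeftSingular e => (singular_block e)^T
  | FiniteJordan k mu => pencil 1%:M (- jordan_block k mu)
  | InfiniteJordan k => pencil (jordan_block k 0) (- 1%:M)
  end.

Fixpoint kcf_rows (s : seq kblock) : nat :=
  if s is b :: s' then (kblock_rows b + kcf_rows s')%N else 0%N.

Fixpoint kcf_cols (s : seq kblock) : nat :=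
  if s is b :: s' then (kblock_cols b + kcf_cols s')%N else 0%N.

Fixpoint kcf_mx (s : seq kblock) : 'M[{poly F}]_(kcf_rows s, kcf_cols s) :=
  if s is b :: s' then block_mx (kblock_mx b) 0 0 (kcf_mx s') else 0.

Definition is_kcf (m n : nat) (P : 'M[{poly F}]_(m, n)) (s : seq kblock) :
    Prop :=
  all kblock_wf s /\
  exists (em : kcf_rows s = m) (en : kcf_cols s = n)
         (S : 'M[F]_m) (T : 'M[F]_n),
    [/\ S \in unitmx, T \in unitmx &
        map_mx polyC S *m P *m map_mx polyC T = castmx (em, en) (kcf_mx s)].

Definition right_indices (s : seq kblock) : seq nat :=
  pmap (fun b => if b is RightSingular e then Some e else None) s.

Definition left_indices (s : seq kblock) : seq nat :=
  pmap (fun b => if b is LeftSingular e then Some e else None) s.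

(* [l] is the nondecreasing list, with repetitions, of the minimal indices
   of [P]; Kronecker's theorem (over an algebraically closed field) says that
   exactly one such list exists. *)
Definition right_minimal_indices (m n : nat) (P : 'M[{poly F}]_(m, n))
    (l : seq nat) : Prop :=
  exists2 s, is_kcf P s & l = sort leq (right_indices s).

Definition left_minimal_indices (m n : nat) (P : 'M[{poly F}]_(m, n))
    (l : seq nat) : Prop :=
  exists2 s, is_kcf P s & l = sort leq (left_indices s).

End Kronecker.

(* Main.v *)
Require Import Defs.
From HB Require Import structures.
From mathcomp Require Import all_boot all_order all_algebra.
From mathcomp Require Import spectral reals complex.
From mathcomp Require Import zify ring.
Set Implicit Arguments.
Unset Strict Implicit.
Unset Printing Implicit Defensive.
Import Order.TTheory GRing.Theory Num.Theory.
Local Open Scope ring_scope.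
Local Open Scope sesquilinear_scope.

(** Why the theorem holds.  Write A = J1 + R1, B = J2 + R2 and
    P = lambda A + B.  If P x = 0 for a polynomial vector x, then for every
    real a > 0 the vector v = x(a) satisfies v^* (a A + B) v = 0.  Skew-adjoint
    matrices contribute only imaginary numbers to this form, so its real part
    is a v^* R1 v + v^* R2 v = 0; both terms are nonnegative, hence
    R1 v = R2 v = 0.  As this happens at infinitely many points a, the
    polynomial vectors R1 x and R2 x vanish identically, and x is then also
    annihilated by lambda A^* + B^*, which differs from - P only by
    2 (lambda R1 + R2) ([null_vector_adjoint]).  The situation being symmetric,
    P and lambda A^* + B^* annihilate the same polynomial vectors.  Since
    P^T is the entrywise conjugate of lambda A^* + B^*, conjugation of the
    coefficients maps the polynomial null vectors of P onto those of P^T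
    and preserves degrees ([has_nullity_tr_psd]).

    It remains to see that the minimal indices are determined by these null
    vectors.  Those of degree less than d form a finite-dimensional space over
    the base field; its dimension is invariant under constant equivalence,
    additive over diagonal blocks, and equal to max(0, d - e) on a right
    singular block of index e, while all other blocks are injective.  So this
    dimension is the sum of the max(0, d - e) over the right minimal indices e
    of P ([is_kcf_right_nullity]), and over the left ones if P is replaced by
    P^T ([is_kcf_left_nullity]).  These sums, for all d, determine the multiset
    of the e ([perm_eq_truncated_sums]). *)

(** * Multisets of naturals from truncated sums *)

(** The increment of the sum from [d] to [d.+1] counts the entries that are at
    most [d], and the increments of these counts are the multiplicities. *)
Lemma perm_eq_truncated_sums (l1 l2 : seq nat) :
  (forall d, \sum_(e <- l1) (d - e) = \sum_(e <- l2) (d - e))%N ->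
  perm_eq l1 l2.
Proof.
have step l d : (\sum_(e <- l) (d.+1 - e) =
                 \sum_(e <- l) (d - e) + count (fun e => e <= d) l)%N.
  by elim: l => [|e l IHl]; rewrite ?big_nil ?big_cons //= IHl; case: leqP; lia.
move=> eq12.
have eq_cnt d : count (fun e => e <= d)%N l1 = count (fun e => e <= d)%N l2.
  by move: (eq12 d.+1); rewrite !step eq12 => /addnI.
have count_split l d : (count (fun e => e <= d.+1) l =
    count (fun e => e <= d) l + count_mem d.+1 l)%N.
  by elim: l => //= e l ->; case: (ltngtP e d.+1); lia.
apply/allP => d _ /=; apply/eqP; case: d => [|d].
  have count0 l : count_mem 0%N l = count (fun e => e <= 0)%N l.
    by apply: eq_count => e /=; rewrite leqn0.
  by rewrite !count0 eq_cnt.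
by move: (eq_cnt d.+1); rewrite !count_split eq_cnt => /addnI.
Qed.

(** * Dimension of the spaces of polynomial null vectors *)

Section PolynomialNullVectors.
Variable F : fieldType.
Implicit Types d k : nat.

(** The bound [d] on the size means degree less than [d], so that the space for
    [d = 0] is zero. *)
Definition null_vector m n (P : 'M[{poly F}]_(m, n)) d
    (x : 'cV[{poly F}]_n) : Prop :=
  P *m x = 0 /\ forall i, (size (x i 0%R) <= d)%N.

(** The null vectors of bounded degree are a vector space over [F] but not over
    {poly F}, the scalars for which polynomial matrices form a module.  Its
    dimension is therefore expressed through a basis, the columns of [b]; in
    this form bases transform by matrix multiplication under all operations
    used below. *)
Definition has_nullity m n (P : 'M[{poly F}]_(m, n)) d k : Prop :=
  exists b : 'M[{poly F}]_(n, k),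
    (forall x, null_vector P d x <->
               exists u : 'cV[F]_k, x = b *m map_mx polyC u) /\
    (forall u : 'cV[F]_k, b *m map_mx polyC u = 0 -> u = 0).

(** Two bases are expressed in each other by constant matrices, one of which
    is a one-sided inverse of the other. *)
Lemma has_nullity_leq m n (P : 'M[{poly F}]_(m, n)) d k1 k2 :
  has_nullity P d k1 -> has_nullity P d k2 -> (k1 <= k2)%N.
Proof.
have express k k' (b : 'M[{poly F}]_(n, k)) (b' : 'M[{poly F}]_(n, k')) :
    (forall x, null_vector P d x <->
               exists u : 'cV[F]_k, x = b *m map_mx polyC u) ->
    (forall x, null_vector P d x <->
               exists u : 'cV[F]_k', x = b' *m map_mx polyC u) ->
    exists M, b = b' *m map_mx polyC M.
  move=> bP b'P.
  have /fin_all_exists [u uP] (j : 'I_k) :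
      exists u : 'cV[F]_k', col j b = b' *m map_mx polyC u.
    apply/b'P/bP; exists (delta_mx j 0).
    by rewrite map_delta_mx colE.
  exists (\matrix_(i, j) u j i 0); apply/matrixP => i j.
  move/matrixP/(_ i 0): (uP j); rewrite !mxE => ->.
  by apply: eq_bigr => l _; rewrite !mxE.
move=> [b1 [b1P b1_free]] [b2 [b2P _]].
have [M12 eM12] := express _ _ _ _ b1P b2P.
have [M21 eM21] := express _ _ _ _ b2P b1P.
apply: (@mulmx1_min _ _ _ M21 M12); apply/eqP; rewrite -subr_eq0; apply/eqP.
apply/matrixP => i j; rewrite [RHS]mxE.
have /b1_free/matrixP/(_ i 0) :
    b1 *m map_mx polyC (col j (M21 *m M12 - 1%:M)) = 0.
  rewrite colE map_mxM mulmxA map_mxB map_mx1 mulmxBr mulmx1 map_mxM mulmxA.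
  by rewrite -eM21 -eM12 subrr mul0mx.
by rewrite !mxE.
Qed.

Lemma has_nullity_inj m n (P : 'M[{poly F}]_(m, n)) d k1 k2 :
  has_nullity P d k1 -> has_nullity P d k2 -> k1 = k2.
Proof.
move=> h1 h2; apply/eqP.
by rewrite eqn_leq (has_nullity_leq h1 h2) (has_nullity_leq h2 h1).
Qed.

Lemma has_nullity0 m n (P : 'M[{poly F}]_(m, n)) d :
  (forall x : 'cV_n, P *m x = 0 -> x = 0) -> has_nullity P d 0.
Proof.
move=> P_inj; exists 0; split=> [x|u _]; last by rewrite [u]flatmx0.
split=> [[/P_inj-> _]|[u ->]]; first by exists 0; rewrite mul0mx.
by rewrite mul0mx; split=> [|i]; rewrite ?mulmx0 // mxE size_poly0.
Qed.

Lemma has_nullity_block m1 n1 m2 n2 (P1 : 'M[{poly F}]_(m1, n1))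
    (P2 : 'M[{poly F}]_(m2, n2)) d k1 k2 :
  has_nullity P1 d k1 -> has_nullity P2 d k2 ->
  has_nullity (block_mx P1 0 0 P2) d (k1 + k2).
Proof.
move=> [b1 [b1P b1_free]] [b2 [b2P b2_free]].
have split_null x1 x2 : null_vector (block_mx P1 0 0 P2) d (col_mx x1 x2) <->
    null_vector P1 d x1 /\ null_vector P2 d x2.
  rewrite /null_vector mul_block_col !mul0mx addr0 add0r; split.
    rewrite -col_mx0 => -[/eq_col_mx[-> ->] sz]; do 2!split=> //; move=> i.
      by have := sz (lshift _ i); rewrite col_mxEu.
    by have := sz (rshift _ i); rewrite col_mxEd.
  move=> [[-> s1] [-> s2]]; rewrite col_mx0; split=> // i.
  by case: (split_ordP i) => j ->; rewrite ?col_mxEu ?col_mxEd.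
have mul_basis (u1 : 'cV_k1) (u2 : 'cV_k2) :
    block_mx b1 0 0 b2 *m map_mx polyC (col_mx u1 u2) =
    col_mx (b1 *m map_mx polyC u1) (b2 *m map_mx polyC u2).
  by rewrite map_col_mx mul_block_col !mul0mx addr0 add0r.
exists (block_mx b1 0 0 b2); split=> [x|u].
  rewrite -[x]vsubmxK split_null b1P b2P; split.
    by move=> [[u1 ->] [u2 ->]]; exists (col_mx u1 u2).
  move=> [u]; rewrite -[u]vsubmxK mul_basis => /eq_col_mx[-> ->].
  by split; eexists.
rewrite -[u]vsubmxK mul_basis -col_mx0 => /eq_col_mx[/b1_free-> /b2_free->].
by rewrite col_mx0.
Qed.

Lemma size_mulmx_polyC m n (T : 'M[F]_(m, n)) (x : 'cV[{poly F}]_n) d :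
  (forall i, (size (x i 0%R) <= d)%N) ->
  forall i, (size ((map_mx polyC T *m x) i 0%R) <= d)%N.
Proof.
move=> sz i; rewrite mxE; apply: (leq_trans (size_sum _ _ _)).
apply/bigmax_leqP => j _; rewrite mxE mul_polyC.
exact: leq_trans (size_scale_leq _ _) (sz j).
Qed.

(** Constant matrices do not increase degrees, so left multiplication by [T]
    maps the null vectors of the equivalent matrix onto those of [P]. *)
Lemma has_nullity_equiv m n (P : 'M[{poly F}]_(m, n)) (S : 'M[F]_m)
    (T : 'M[F]_n) d k :
  S \in unitmx -> T \in unitmx ->
  has_nullity (map_mx polyC S *m P *m map_mx polyC T) d k ->
  has_nullity P d k.
Proof.
move=> uS uT [b [bP b_free]].
have TK p (x : 'M_(n, p)) :
    map_mx polyC T *m (map_mx polyC (invmx T) *m x) = x.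
  by rewrite mulmxA -map_mxM mulmxV // map_mx1 mul1mx.
have KT p (x : 'M_(n, p)) :
    map_mx polyC (invmx T) *m (map_mx polyC T *m x) = x.
  by rewrite mulmxA -map_mxM mulVmx // map_mx1 mul1mx.
exists (map_mx polyC T *m b); split=> [x|u]; last first.
  move=> /(congr1 (mulmx (map_mx polyC (invmx T)))).
  by rewrite -mulmxA KT mulmx0 => /b_free.
have -> : null_vector P d x <-> null_vector
    (map_mx polyC S *m P *m map_mx polyC T) d (map_mx polyC (invmx T) *m x).
  rewrite /null_vector -!mulmxA TK; split=> -[Px sz].
    by rewrite Px mulmx0; split=> //; apply: size_mulmx_polyC.
  split; last by rewrite -[x]TK; apply: size_mulmx_polyC.
  have := congr1 (mulmx (map_mx polyC (invmx S))) Px.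
  by rewrite [X in X = _]mulmxA -map_mxM mulVmx // map_mx1 mul1mx mulmx0.
rewrite bP; split=> -[u xu]; exists u; first by rewrite -mulmxA -xu TK.
by rewrite xu -mulmxA KT.
Qed.

(** An involution of the field acts semilinearly on the null vectors, but it
    maps bases to bases. *)
Lemma has_nullity_map (f : {rmorphism F -> F}) m n
    (P : 'M[{poly F}]_(m, n)) d k :
  involutive f ->
  has_nullity P d k -> has_nullity (map_mx (map_poly f) P) d k.
Proof.
move=> fK [b [bP b_free]].
have FK p q (M : 'M[{poly F}]_(p, q)) :
    map_mx (map_poly f) (map_mx (map_poly f) M) = M.
  apply/matrixP => i j; rewrite !mxE; apply/polyP => l.
  by rewrite !coef_map /= fK.
have mapC p q (M : 'M[F]_(p, q)) :
    map_mx (map_poly f) (map_mx polyC M) = map_mx polyC (map_mx f M).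
  by apply/matrixP => i j; rewrite !mxE map_polyC.
exists (map_mx (map_poly f) b); split=> [x|u].
  have -> : null_vector (map_mx (map_poly f) P) d x <->
            null_vector P d (map_mx (map_poly f) x).
    rewrite /null_vector; split=> -[Px sz]; (split; last first).
    - by move=> i; rewrite mxE size_map_poly.
    - by rewrite -[P]FK -map_mxM Px map_mx0.
    - by move=> i; have := sz i; rewrite mxE size_map_poly.
    - by rewrite -[x]FK -map_mxM Px map_mx0.
  rewrite bP; split=> -[u xu]; exists (map_mx f u).
    by rewrite -mapC -map_mxM -xu FK.
  by rewrite xu map_mxM FK mapC.
move=> /(congr1 (map_mx (map_poly f))); rewrite map_mxM FK mapC map_mx0.
by move=> /b_free/(congr1 (map_mx f)); rewrite map_mx0 -map_mx_comp map_mx_id.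
Qed.

Lemma det_neq0_null n (P : 'M[{poly F}]_n) (x : 'cV_n) :
  \det P != 0 -> P *m x = 0 -> x = 0.
Proof.
move=> nzP /(congr1 (mulmx (\adj P))).
rewrite mulmxA mul_adj_mx mulmx0 mul_scalar_mx => /matrixP Px.
apply/matrixP => i j; have := Px i j; rewrite !mxE => /eqP.
by rewrite mulf_eq0 (negPf nzP) => /eqP.
Qed.

(** * Null vectors of the Kronecker blocks *)

Lemma singular_block_mulE e (x : 'cV[{poly F}]_e.+1) (i : 'I_e) :
  (singular_block F e *m x) i 0 =
  'X * x (widen_ord (leqnSn e) i) 0 - x (lift ord0 i) 0.
Proof.
rewrite mxE (eq_bigr (fun j : 'I_e.+1 =>
    (if j == widen_ord (leqnSn e) i then 'X * x j 0 else 0) +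
    (if j == lift ord0 i then - x j 0 else 0))).
  by rewrite big_split /= -!big_mkcond /= !big_pred1_eq.
move=> j _; rewrite !mxE -!val_eqE /= /bump add1n.
by do 2!case: eqP => _; rewrite ?oppr0 /= ?polyCN; ring.
Qed.

(** A null vector has the form (p, X p, ..., X^e p), where the bound on the
    last entry forces [p] to have degree less than [d - e]. *)
Lemma has_nullity_singular_block e d :
  has_nullity (singular_block F e) d (d - e).
Proof.
pose b := \matrix_(i < e.+1, j < d - e) 'X^(i + j) : 'M[{poly F}]_(_, _).
have bE u i : (b *m map_mx polyC u) i 0 = 'X^i * rVpoly u^T.
  rewrite mxE /rVpoly poly_def mulr_sumr; apply: eq_bigr => j _.
  by rewrite !mxE valK mxE exprD -mul_polyC; ring.
exists b; split=> [x|u]; last first.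
  move=> /matrixP/(_ 0 0); rewrite bE mul1r mxE => u0.
  by rewrite -[u]trmxK -[u^T]rVpolyK u0 linear0 trmx0.
split=> [[Px sz]|[u ->]].
  have xE i (lt_ie : (i < e.+1)%N) : x (Ordinal lt_ie) 0 = 'X^i * x 0 0.
    elim: i lt_ie => [|i IHi] lt_ie.
      by rewrite mul1r; congr (x _ _); apply: val_inj.
    have lt_ie' : (i < e)%N by [].
    have /matrixP/(_ (Ordinal lt_ie') 0)/eqP := Px.
    rewrite singular_block_mulE mxE subr_eq0 => /eqP.
    have -> : lift ord0 (Ordinal lt_ie') = Ordinal lt_ie by apply: val_inj.
    move=> <-; rewrite exprS -mulrA -(IHi (ltnW lt_ie)).
    by congr (_ * x _ _); apply: val_inj.
  have sz0 : (size (x 0%R 0%R) <= d - e)%N.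
    have := sz ord_max; rewrite xE; have [->|nz] := eqVneq (x 0 0) 0.
      by rewrite size_poly0.
    by rewrite mulrC size_mulXn //; lia.
  exists (poly_rV (x 0 0))^T; apply/matrixP => i j; rewrite ord1.
  by rewrite bE trmxK poly_rV_K // -xE; congr (x _ _); apply: val_inj.
split=> [|i].
  apply/matrixP => i j; rewrite ord1 singular_block_mulE !bE mxE /=.
  by rewrite /bump add1n exprS mulrA subrr.
rewrite bE; have [->|nz] := eqVneq (rVpoly u^T) 0.
  by rewrite mulr0 size_poly0.
have szp : (size (rVpoly u^T) <= d - e)%N by exact: size_poly.
move: (nz); rewrite -size_poly_gt0 mulrC size_mulXn // => nz'.
by move: szp nz' (ltn_ord i); set s := size _; lia.
Qed.

(** The equations are 'X * y_i = y_(i-1) with y_(-1) = 0. *)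
Lemma singular_block_tr_null e (y : 'cV[{poly F}]_e) :
  (singular_block F e)^T *m y = 0 -> y = 0.
Proof.
move=> Py; have y0 i (lt_ie : (i < e)%N) : y (Ordinal lt_ie) 0 = 0.
  elim/ltn_ind: i lt_ie => i IHi lt_ie; set i0 := Ordinal lt_ie.
  have /matrixP/(_ (widen_ord (leqnSn e) i0) 0)/eqP := Py.
  rewrite mxE [X in _ == X]mxE (bigD1 i0) //= big1 ?addr0 => [|[k lt_ke] ne_ki].
    rewrite !mxE /= eqxx (ltn_eqF (ltnSn i)) oppr0 polyC0 addr0 mulr1.
    by rewrite mulf_eq0 polyX_eq0 => /eqP.
  have [/IHi->|le_ik] := ltnP k i; first by rewrite mulr0.
  have lt_ik : (i < k)%N by rewrite ltn_neqAle eq_sym ne_ki.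
  rewrite !mxE /= (ltn_eqF lt_ik) (ltn_eqF (ltnW lt_ik : i < k.+1)%N).
  by rewrite oppr0 polyC0 mulr0 addr0 mul0r.
by apply/matrixP => -[i lt_ie] j; rewrite ord1 y0 mxE.
Qed.

(** The Jordan blocks are bidiagonal, so the determinant of either regular block
    is the product of its diagonal entries: powers of X - mu and of -1. *)
Lemma finite_jordan_det k (mu : F) :
  \det (pencil 1%:M (- jordan_block k mu)) != 0.
Proof.
rewrite -det_tr det_trig; last first.
  apply/is_trig_mxP => i j lt_ij; rewrite !mxE.
  rewrite -!val_eqE /= (gtn_eqF lt_ij) (ltn_eqF lt_ij) (ltn_eqF (leqW lt_ij)).
  by rewrite mulr0n addr0 oppr0 polyC0 mulr0 addr0.
apply/prodf_neq0 => i _; rewrite !mxE eqxx (ltn_eqF (ltnSn i)) addr0 mulr1n.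
by rewrite polyCN mulr1 polyXsubC_eq0.
Qed.

Lemma infinite_jordan_det k :
  \det (pencil (jordan_block k 0) (- 1%:M) : 'M[{poly F}]_k) != 0.
Proof.
rewrite -det_tr det_trig; last first.
  apply/is_trig_mxP => i j lt_ij; rewrite !mxE.
  rewrite -!val_eqE /= (gtn_eqF lt_ij) (ltn_eqF (leqW lt_ij)).
  by rewrite mul0rn addr0 oppr0 polyC0 mulr0 addr0.
apply/prodf_neq0 => i _; rewrite !mxE eqxx (ltn_eqF (ltnSn i)) mul0rn addr0.
by rewrite polyC0 mulr0 add0r polyCN oppr_eq0 oner_eq0.
Qed.

Lemma kblock_right_nullity (b : kblock F) d :
  has_nullity (kblock_mx b) d (\sum_(e <- right_indices [:: b]) (d - e)).
Proof.
case: b => [e|e|k mu|k] /=; rewrite ?big_seq1 ?big_nil.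
- exact: has_nullity_singular_block.
- by apply: has_nullity0 => x; apply: singular_block_tr_null.
- by apply: has_nullity0 => x; apply/det_neq0_null/finite_jordan_det.
- by apply: has_nullity0 => x; apply/det_neq0_null/infinite_jordan_det.
Qed.

Lemma kblock_left_nullity (b : kblock F) d :
  has_nullity (kblock_mx b)^T d (\sum_(e <- left_indices [:: b]) (d - e)).
Proof.
case: b => [e|e|k mu|k] /=; rewrite ?big_seq1 ?big_nil.
- by apply: has_nullity0 => x; apply: singular_block_tr_null.
- by rewrite trmxK; apply: has_nullity_singular_block.
- apply: has_nullity0 => x; apply: det_neq0_null.
  by rewrite det_tr finite_jordan_det.
- apply: has_nullity0 => x; apply: det_neq0_null.
  by rewrite det_tr infinite_jordan_det.
Qed.

(** * Null vectors of the Kronecker canonical form *)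

Lemma kcf_right_nullity s d :
  has_nullity (kcf_mx s) d (\sum_(e <- right_indices s) (d - e)).
Proof.
elim: s => [|b s IHs].
  by rewrite big_nil; apply: has_nullity0 => x _; rewrite [x]flatmx0.
have -> : right_indices (b :: s) = right_indices [:: b] ++ right_indices s.
  by case: b.
rewrite big_cat; apply: has_nullity_block IHs; exact: kblock_right_nullity.
Qed.

Lemma kcf_left_nullity s d :
  has_nullity (kcf_mx s)^T d (\sum_(e <- left_indices s) (d - e)).
Proof.
elim: s => [|b s IHs].
  by rewrite big_nil; apply: has_nullity0 => x _; rewrite [x]flatmx0.
have -> : left_indices (b :: s) = left_indices [:: b] ++ left_indices s.
  by case: b.
rewrite big_cat /= tr_block_mx !trmx0.
apply: has_nullity_block IHs; exact: kblock_left_nullity.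
Qed.

Lemma is_kcf_right_nullity m n (P : 'M_(m, n)) (s : seq (kblock F)) d :
  is_kcf P s -> has_nullity P d (\sum_(e <- right_indices s) (d - e)).
Proof.
move=> [_ [em [en [S [T [uS uT eP]]]]]].
apply: (has_nullity_equiv uS uT); rewrite eP.
by case: m / em {P S uS eP}; case: n / en {T uT}; apply: kcf_right_nullity.
Qed.

Lemma is_kcf_left_nullity m n (P : 'M_(m, n)) (s : seq (kblock F)) d :
  is_kcf P s -> has_nullity P^T d (\sum_(e <- left_indices s) (d - e)).
Proof.
move=> [_ [em [en [S [T [uS uT eP]]]]]].
apply: (@has_nullity_equiv _ _ _ T^T S^T); rewrite ?unitmx_tr //.
rewrite -!map_trmx -!trmx_mul mulmxA eP.
by case: m / em {P S uS eP}; case: n / en {T uT}; apply: kcf_left_nullity.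
Qed.

End PolynomialNullVectors.

(** * Pencils whose coefficients have positive semidefinite Hermitian part *)

Section PositiveHermitianParts.
Variable C : numClosedFieldType.

(** With y = R x, nonnegativity of the form at x - t y for small t > 0
    contradicts y <> 0, as the form equals - 2 t y^* y up to order t^2. *)
Lemma psdmx_null n (R : 'M[C]_n) (x : 'cV_n) :
  psdmx R -> (x ^t* *m R *m x) 0 0 = 0 -> R *m x = 0.
Proof.
move=> [R_herm R_ge0] xRx0; set y := R *m x.
have Rx_tr : x ^t* *m R = y ^t* by rewrite /y trmx_mul map_mxM R_herm.
set c := (y ^t* *m y) 0 0; set e := (y ^t* *m R *m y) 0 0.
have e_ge0 : 0 <= e by apply: R_ge0.
have cE : c = \sum_i `|y i 0| ^+ 2.
  by rewrite /c mxE; apply: eq_bigr => i _; rewrite !mxE normCKC.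
have c_ge0 : 0 <= c by rewrite cE sumr_ge0 // => i _; rewrite exprn_ge0.
have quad t : t \is Num.real -> 0 <= t ^+ 2 * e - 2 * t * c.
  move=> /CrealP t_real; have := R_ge0 (x - t *: y).
  have -> : (x - t *: y) ^t* = x ^t* - t *: y ^t*.
    by apply/matrixP => i j; rewrite !mxE rmorphB rmorphM /= t_real.
  have entryB (M N : 'M[C]_1) : (M - N) 0 0 = M 0 0 - N 0 0 by rewrite !mxE.
  have entryZ a (M : 'M[C]_1) : (a *: M) 0 0 = a * M 0 0 by rewrite mxE.
  rewrite mulmxBl mulmxBr !mulmxBl -!scalemxAl -!scalemxAr.
  rewrite !(entryB, entryZ) xRx0 -[y ^t* *m R *m x]mulmxA -/y Rx_tr -/c -/e.
  by congr (0 <= _); ring.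
have c0 : c = 0.
  have e1_gt0 : 0 < e + 1 by rewrite ltr_wpDl.
  (* The form at x - t y is t^2 e - 2 t c, which is - t^2 (e + 2) for this t. *)
  pose t := c / (e + 1); have t_ge0 : 0 <= t by rewrite divr_ge0 // ltW.
  have cEt : c = t * (e + 1) by rewrite divfK // gt_eqF.
  have e2_gt0 : 0 < e + 2 by rewrite ltr_wpDl.
  have := quad t (ger0_real t_ge0).
  have -> : t ^+ 2 * e - 2 * t * c = - (t ^+ 2 * (e + 2)) by rewrite cEt; ring.
  rewrite oppr_ge0 pmulr_lle0 // => t2_le0.
  have /eqP : t ^+ 2 == 0 by rewrite eq_le t2_le0 exprn_ge0.
  by move/eqP; rewrite sqrf_eq0 => /eqP t0; rewrite cEt t0 mul0r.
apply/matrixP => i j; rewrite ord1 [RHS]mxE; apply/eqP.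
move: c0; rewrite cE => /eqP.
rewrite psumr_eq0 => [|k _]; last by rewrite exprn_ge0.
by move=> /allP/(_ i (mem_index_enum _)); rewrite expf_eq0 /= normr_eq0.
Qed.

Lemma poly_eq0_natS (p : {poly C}) :
  (forall k : nat, p.[k.+1%:R] = 0) -> p = 0.
Proof.
move=> p0; pose rs := [seq k.+1%:R : C | k <- iota 0 (size p)].
apply: (@roots_geq_poly_eq0 _ p rs).
- by apply/allP => _ /mapP[k _ ->]; apply/rootP.
- by rewrite map_inj_uniq ?iota_uniq // => a b /eqP; rewrite eqr_nat => /eqP[].
- by rewrite size_map size_iota.
Qed.

(** At a point [a > 0], adding the equation v^* (a A + B) v = 0 to its conjugate
    cancels the skew-adjoint parts and leaves a vanishing sum of nonnegative
    terms.  Positivity of [a] keeps both terms nonnegative; the positive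
    integers already are enough points to identify polynomials. *)
Lemma null_vector_psd_parts n (J1 R1 J2 R2 : 'M[C]_n) (x : 'cV[{poly C}]_n) :
  J1 ^t* = - J1 -> J2 ^t* = - J2 -> psdmx R1 -> psdmx R2 ->
  pencil (J1 + R1) (J2 + R2) *m x = 0 ->
  map_mx polyC R1 *m x = 0 /\ map_mx polyC R2 *m x = 0.
Proof.
move=> hJ1 hJ2 hR1 hR2 Px.
have skew_form (J : 'M[C]_n) (v : 'cV_n) :
    J ^t* = - J -> ((v ^t* *m J *m v) 0 0)^* = - (v ^t* *m J *m v) 0 0.
  move=> hJ; have vJv_tr : (v ^t* *m J *m v) ^t* = - (v ^t* *m J *m v).
    by rewrite !trmx_mul !map_mxM trmxCK hJ mulNmx mulmxN mulmxA.
  by have /matrixP/(_ 0 0) := vJv_tr; rewrite !mxE.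
have eval (R : 'M[C]_n) (a : C) (i : 'I_n) :
    ((map_mx polyC R *m x) i 0).[a] = (R *m map_mx (horner_eval a) x) i 0.
  rewrite !mxE horner_sum; apply: eq_bigr => j _.
  by rewrite !mxE hornerM hornerC.
suff null_at k (v := map_mx (horner_eval k.+1%:R) x) :
    R1 *m v = 0 /\ R2 *m v = 0.
  split; apply/matrixP => i j; rewrite ord1 [RHS]mxE; apply: poly_eq0_natS => k.
    by rewrite eval (null_at k).1 mxE.
  by rewrite eval (null_at k).2 mxE.
have a_gt0 : 0 < k.+1%:R :> C by rewrite ltr0Sn.
set a : C := k.+1%:R in v a_gt0 *.
have Pv : (a *: (J1 + R1) + (J2 + R2)) *m v = 0.
  have <- : map_mx (horner_eval a) (pencil (J1 + R1) (J2 + R2)) =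
            a *: (J1 + R1) + (J2 + R2).
    apply/matrixP => i j; rewrite !mxE /horner_eval.
    by rewrite hornerD hornerM hornerX !hornerC.
  by rewrite -map_mxM Px map_mx0.
pose q (M : 'M[C]_n) := (v ^t* *m M *m v) 0 0.
have qE : a * (q J1 + q R1) + (q J2 + q R2) = 0.
  have : (v ^t* *m ((a *: (J1 + R1) + (J2 + R2)) *m v)) 0 0 = 0.
    by rewrite Pv mulmx0 mxE.
  have entryD (M N : 'M[C]_1) : (M + N) 0 0 = M 0 0 + N 0 0 by rewrite !mxE.
  have entryZ b (M : 'M[C]_1) : (b *: M) 0 0 = b * M 0 0 by rewrite mxE.
  rewrite mulmxA mulmxDr mulmxDl -scalemxAr -scalemxAl !mulmxDr !mulmxDl.
  by rewrite !(entryD, entryZ).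
have qR1 : 0 <= q R1 := hR1.2 v.
have qR2 : 0 <= q R2 := hR2.2 v.
have sum0 : a * q R1 + q R2 = 0.
  have a_conj : a^* = a by rewrite geC0_conj // ltW.
  have : (a * (q J1 + q R1) + (q J2 + q R2))^* = 0 by rewrite qE conjC0.
  have qJ1 : (q J1)^* = - q J1 := skew_form _ v hJ1.
  have qJ2 : (q J2)^* = - q J2 := skew_form _ v hJ2.
  rewrite !(rmorphD, rmorphM) /= a_conj qJ1 qJ2 !geC0_conj // => qE'.
  have : (2 : C) * (a * q R1 + q R2) = 0.
    by rewrite -[RHS]addr0 -{1}qE -qE'; ring.
  by move/eqP; rewrite mulf_eq0 pnatr_eq0 => /eqP.
have aq1 : 0 <= a * q R1 by rewrite mulr_ge0 // ltW.
have /eqP := sum0; rewrite paddr_eq0 // mulf_eq0 (gt_eqF a_gt0) /=.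
by case/andP=> /eqP q1 /eqP q2; split; apply: psdmx_null.
Qed.

(** The coefficients of the second pencil are the adjoints of those of the
    first. *)
Lemma null_vector_adjoint n (J1 R1 J2 R2 : 'M[C]_n) (x : 'cV[{poly C}]_n) :
  J1 ^t* = - J1 -> J2 ^t* = - J2 -> psdmx R1 -> psdmx R2 ->
  pencil (J1 + R1) (J2 + R2) *m x = 0 ->
  pencil (- J1 + R1) (- J2 + R2) *m x = 0.
Proof.
move=> hJ1 hJ2 hR1 hR2 Px.
have [R1x R2x] := null_vector_psd_parts hJ1 hJ2 hR1 hR2 Px.
move: Px; rewrite /pencil !map_mxD !map_mxN !mulmxDl -!scalemxAl !mulmxDl.
by rewrite R1x R2x !addr0 !mulNmx scalerN -opprD => ->; rewrite oppr0.
Qed.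

(** The second pencil of [null_vector_adjoint] satisfies the same hypotheses and
    leads back to the first, so both have the same null vectors and a basis for
    one serves the other.  The transpose is the conjugate of that pencil. *)
Lemma has_nullity_tr_psd n (J1 R1 J2 R2 : 'M[C]_n) d k :
  J1 ^t* = - J1 -> J2 ^t* = - J2 -> psdmx R1 -> psdmx R2 ->
  has_nullity (pencil (J1 + R1) (J2 + R2)) d k ->
  has_nullity (pencil (J1 + R1) (J2 + R2))^T d k.
Proof.
move=> hJ1 hJ2 hR1 hR2 [b [bP b_free]].
have -> : (pencil (J1 + R1) (J2 + R2))^T =
    map_mx (map_poly Num.conj) (pencil (- J1 + R1) (- J2 + R2)).
  rewrite -hJ1 -hJ2 -{2}hR1.1 -{2}hR2.1; apply/matrixP => i j; rewrite !mxE.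
  rewrite (rmorphD (map_poly _)) (rmorphM (map_poly _)) /= map_polyX.
  rewrite !map_polyC /=.
  by rewrite !(rmorphD Num.conj) /= !conjCK.
apply: (has_nullity_map (f := Num.conj)); first exact: conjCK.
exists b; split=> // x; rewrite -bP /null_vector.
split=> -[Px sz]; split=> //; last exact: null_vector_adjoint Px.
rewrite -[J1]opprK -[J2]opprK; apply: null_vector_adjoint Px => //.
- by rewrite linearN map_mxN hJ1.
- by rewrite linearN map_mxN hJ2.
Qed.

End PositiveHermitianParts.

Theorem corollary4p5 (R : realType) (F : {pred R[i]})
    (hF : F =i Num.real \/ F =i predT)
    (n : nat) (J1 R1 J2 R2 : 'M[R[i]]_n)
    (hPF1 : J1 + R1 \is a mxOver F) (hPF2 : J2 + R2 \is a mxOver F)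
    (hJ1 : J1 ^t* = - J1) (hJ2 : J2 ^t* = - J2)
    (hR1 : psdmx R1) (hR2 : psdmx R2)
    (left_list right_list : seq nat)
    (hleft : left_minimal_indices (pencil (J1 + R1) (J2 + R2)) left_list)
    (hright : right_minimal_indices (pencil (J1 + R1) (J2 + R2)) right_list) :
  left_list = right_list.
Proof.
case: hleft hright => [sl kcf_sl ->] [sr kcf_sr ->].
apply/(perm_sortP leq_total leq_trans anti_leq)/perm_eq_truncated_sums => d.
apply: has_nullity_inj (is_kcf_left_nullity d kcf_sl) _.
exact: has_nullity_tr_psd (is_kcf_right_nullity d kcf_sr).
Qed.
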